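(* Let $\omega_i$ be a mesh patch in $\mathbb{R}^2$ around the node $\mathbf{x}_i=(x_i,y_i)$ with surrounding nodes $\mathbf{x}_j=(x_j,y_j)$, $j\in S_i$. For $p\in\mathbb{Q}_1(\omega_i)$ write $p_i=p(\mathbf{x}_i)$, $p_j=p(\mathbf{x}_j)$, $p_i^{\min}=\min_{j\in S_i}p_j$ and $p_i^{\max}=\max_{j\in S_i}p_j$. Then: (1) $p_i^{\min}\le p_i\le p_i^{\max}$ holds for all $p\in\mathbb{Q}_1(\omega_i)$ if and only if $\omega_i$ is bilinearly convex; (2) $\omega_i$ satisfies the bilinear maximum principle (that is, $p_i^{\min}\le p_i\le p_i^{\max}$ for all $p\in\mathbb{Q}_1(\omega_i)$, with equality in either inequality only for constant $p$) if and only if $\omega_i$ is strictly bilinearly convex.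
   Context: $\mathcal{T}_h$ is an admissible triangulation (mesh) of a bounded domain $\Omega\subset\mathbb{R}^2$ with nodes $\mathbf{x}_1,\dots,\mathbf{x}_n$, of which $\mathbf{x}_1,\dots,\mathbf{x}_m$ are the non-Dirichlet (interior) nodes. For $i\in\{1,\dots,m\}$ the patch is $\omega_i=\bigcup\{K\in\mathcal{T}_h:\mathbf{x}_i\in K\}$, and $S_i=\{j\in\{1,\dots,n\}\setminus\{i\}:\mathbf{x}_j\in\omega_i\}$ is the (finite) set of indices of surrounding nodes. $\mathbb{Q}_1(\omega_i)$ is the space of bilinear functions $p(x,y)=a+bx+cy+dxy$, $a,b,c,d\in\mathbb{R}$, on $\omega_i$ (one polynomial in the physical coordinates on the whole patch). Lifted points: $\mathbf{P}_j=\bigl(x_j-x_i,\;y_j-y_i,\;(x_j-x_i)(y_j-y_i)\bigr)^\top\in\mathbb{R}^3$, $j\in S_i$. The patch $\omega_i$ is called bilinearly convex if the convex hull of $\{\mathbf{P}_j\}_{j\in S_i}$ contains the origin of $\mathbb{R}^3$, and strictly bilinearly convex if the origin lies in the relative interior of that convex hull, that is, if there exist weights $\alpha_j>0$, $j\in S_i$, with $\sum_{j\in S_i}\alpha_j=1$ and $\sum_{j\in S_i}\alpha_j\mathbf{P}_j=\mathbf{0}$.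
   Formalization: In (2), strict bilinear convexity does not force p constant on the whole patch (four triangles, p=xy); (2) is proved with ''constant'' meaning equal values at the patch's nodes, and with p constant on the whole patch when the lifted points P_j span R^3. *)

(* Defs.v *)
From mathcomp Require Export all_boot all_order all_algebra.
From mathcomp Require Export all_classical all_reals all_analysis.
Export Order.TTheory GRing.Theory Num.Theory.
Export numFieldNormedType.Exports.

Set Implicit Arguments.
Unset Strict Implicit.
Unset Printing Implicit Defensive.

Local Open Scope classical_set_scope.
Local Open Scope ring_scope.

Definition hull (R : realType) (V : lmodType R) (I : finType) (A : {set I})
    (P : I -> V) : set V :=
  [set v | exists a : I -> R,
     [/\ forall j, j \in A -> 0 <= a j,
         \sum_(j in A) a j = 1 &
         \sum_(j in A) a j *: P j = v]].

Definition xcoord (R : realType) (z : 'rV[R]_2) : R := z 0 0.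
Definition ycoord (R : realType) (z : 'rV[R]_2) : R := z 0 1.

(* An element is given by its set K of vertices and is the closed convex
   polygon spanned by them; triangles (#|K| = 3) and convex quadrilaterals
   (#|K| = 4) are the usual cases.  [elt_strict] says that every vertex is an
   extreme point, so that, with at least three vertices, elements have nonempty
   interior.  Two distinct elements meet in the hull of their common vertices;
   as there are at most two of these, the intersection is empty, a vertex or an
   edge. *)
Record mesh (R : realType) := Mesh {
  domain : set 'rV[R]_2;
  nb_nodes : nat;
  nb_interior : nat;
  node : 'I_nb_nodes -> 'rV[R]_2;
  elements : {set {set 'I_nb_nodes}};
  domain_nonempty : domain !=set0;
  domain_open : open domain;
  domain_connected : connected domain;
  domain_bounded : bounded_set domain;
  nb_interior_le : (nb_interior <= nb_nodes)%N;
  node_inj : injective node;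
  interior_nodeP :
    forall j : 'I_nb_nodes, (j < nb_interior)%N <-> domain (node j);
  node_vertex : forall j, exists2 K, K \in elements & j \in K;
  elt_card : forall K, K \in elements -> (2 < #|K|)%N;
  elt_strict : forall K j, K \in elements -> j \in K ->
    ~ hull (K :\ j)%SET node (node j);
  elt_cover : \bigcup_(K in [set` elements]) hull K node = closure domain;
  elt_conforming : forall K L, K \in elements -> L \in elements -> K != L ->
    hull K node `&` hull L node = hull (K :&: L)%SET node
    /\ (#|(K :&: L)%SET| <= 2)%N }.

Section Patch.
Variables (R : realType) (T : mesh R) (i : 'I_(nb_nodes T)).

Definition patch : set 'rV[R]_2 :=
  \bigcup_(K in [set K | K \in elements T /\ hull K (@node R T) (node i)])
    hull K (@node R T).

Definition surrounding : {set 'I_(nb_nodes T)} :=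
  [set j | (j != i) && `[< patch (node j) >]]%SET.

Definition lifted (j : 'I_(nb_nodes T)) : 'rV[R]_3 :=
  let dx := xcoord (node j) - xcoord (node i) in
  let dy := ycoord (node j) - ycoord (node i) in
  \row_(k < 3) [:: dx; dy; dx * dy]`_k.

Definition bilinearly_convex : Prop := hull surrounding lifted 0.

Definition strictly_bilinearly_convex : Prop :=
  exists a : 'I_(nb_nodes T) -> R,
    [/\ forall j, j \in surrounding -> 0 < a j,
        \sum_(j in surrounding) a j = 1 &
        \sum_(j in surrounding) a j *: lifted j = 0].

(* Elements of Q_1 on a set D are functions on D: the values of p outside D are
   irrelevant. *)
Definition bilinear_on (D : set 'rV[R]_2) (p : 'rV[R]_2 -> R) : Prop :=
  exists a b c d : R, forall z, D z ->
    p z = a + b * xcoord z + c * ycoord z + d * (xcoord z * ycoord z).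

Definition constant_on (D : set 'rV[R]_2) (p : 'rV[R]_2 -> R) : Prop :=
  forall z w, D z -> D w -> p z = p w.

(* Genuine minimum and maximum over the finite nonempty set of surrounding
   nodes; extended reals only supply the neutral elements. *)
Definition pmin (p : 'rV[R]_2 -> R) : \bar R :=
  \big[Order.min/+oo%E]_(j in surrounding) (p (node j))%:E.

Definition pmax (p : 'rV[R]_2 -> R) : \bar R :=
  \big[Order.max/-oo%E]_(j in surrounding) (p (node j))%:E.

Definition locally_bounded_by_neighbours (p : 'rV[R]_2 -> R) : Prop :=
  (pmin p <= (p (node i))%:E)%E /\ ((p (node i))%:E <= pmax p)%E.

(* The set D is where constancy is asserted in the case of equality. *)
Definition bilinear_max_principle_wrt (D : set 'rV[R]_2) : Prop :=
  forall p, bilinear_on patch p ->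
    locally_bounded_by_neighbours p /\
    (pmin p = (p (node i))%:E \/ (p (node i))%:E = pmax p -> constant_on D p).

Definition patch_nodes : set 'rV[R]_2 :=
  [set z | exists2 j, j \in (i |: surrounding)%SET & z = node j].

(* A nonconstant bilinear function may take one single value at all nodes of
   the patch: p(x,y) = xy does on the four triangles joining (0,0) to the
   consecutive points of (1,0), (0,1), (-1,0), (0,-1).  Strict bilinear
   convexity, which involves the nodes only and holds there with equal weights,
   thus characterizes the maximum principle with constancy understood at the
   nodes.  Constancy on the whole patch is the same thing precisely when the
   lifted points span R^3, that is, when the relative interior of a hull
   containing the origin is its interior. *)
Definition bilinear_max_principle_nodes : Prop :=
  bilinear_max_principle_wrt patch_nodes.

Definition bilinear_max_principle : Prop := bilinear_max_principle_wrt patch.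

Definition nondegenerate_patch : Prop :=
  (<<[seq lifted j | j <- enum surrounding]>> = fullv)%VS.

End Patch.

(* Main.v *)
Require Import Defs.
From mathcomp Require Import lra.

(** Around the node x_i, every bilinear function is p = p(x_i) + l o P, where
    P is the lift (dx, dy, dx dy) and l a linear form on R^3, and conversely
    every l arises in this way.  So both parts are statements about the signs
    that a linear form can take on the lifted nodes P_j.

    From weights to bounds: if 0 = sum a_j P_j is a convex combination, then
    the numbers l(P_j) = p_j - p_i have weighted sum 0, hence are neither all
    positive nor all negative; and if all the weights are positive and the
    numbers have a weak common sign, they vanish.  They are then zero at the
    nodes; when the P_j span R^3 this forces l = 0, that is, p is constant on
    the patch.

    From bounds to weights: the tool is Farkas' lemma, in the shape of a
    dichotomy for each fixed index k ([tucker_alternative]): either some linear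
    form is nonnegative on all the P_j and positive at P_k, or some vanishing
    nonnegative combination of the P_j gives P_k a positive weight.
    If the second case never occurs, the sum over k of the forms is positive on
    every P_j, and the corresponding p violates p_min <= p_i.  If the first
    case never occurs, the sum over k of the combinations has positive weights
    only; and the first case does contradict the maximum principle, because its
    p satisfies p_min = p_i without being constant on the nodes. *)

Set Implicit Arguments.
Unset Strict Implicit.
Unset Printing Implicit Defensive.

Local Open Scope classical_set_scope.
Local Open Scope ring_scope.

(** * Theorems of the alternative over an ordered field *)

Section Alternative.
Variables (F : realFieldType) (n : nat).
Implicit Types (u v : 'rV[F]_n) (c d : 'cV[F]_n).

Definition pairing v c : F := (v *m c) 0 0.

Lemma pairingDl u v c : pairing (u + v) c = pairing u c + pairing v c.
Proof. by rewrite /pairing mulmxDl mxE. Qed.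

Lemma pairingNl v c : pairing (- v) c = - pairing v c.
Proof. by rewrite /pairing mulNmx mxE. Qed.

Lemma pairingZl a v c : pairing (a *: v) c = a * pairing v c.
Proof. by rewrite /pairing -scalemxAl mxE. Qed.

Lemma pairing_suml (I : finType) (A : {set I}) (P : I -> 'rV[F]_n) c :
  pairing (\sum_(j in A) P j) c = \sum_(j in A) pairing (P j) c.
Proof. by rewrite /pairing mulmx_suml summxE. Qed.

Lemma pairingDr v c d : pairing v (c + d) = pairing v c + pairing v d.
Proof. by rewrite /pairing mulmxDr mxE. Qed.

Lemma pairingZr a v c : pairing v (a *: c) = a * pairing v c.
Proof. by rewrite /pairing -scalemxAr mxE. Qed.

Lemma pairing_sumr (I : finType) (A : {set I}) v (c : I -> 'cV[F]_n) :
  pairing v (\sum_(j in A) c j) = \sum_(j in A) pairing v (c j).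
Proof. by rewrite /pairing mulmx_sumr summxE. Qed.

Lemma pairing_tr v : pairing v v^T = \sum_k v 0 k ^+ 2.
Proof. by rewrite /pairing mxE; apply: eq_bigr => k _; rewrite mxE -expr2. Qed.

Lemma pairing_tr_gt0 v : v != 0 -> 0 < pairing v v^T.
Proof.
move=> v0; rewrite pairing_tr lt_neqAle sumr_ge0 ?andbT; last first.
  by move=> k _; exact: sqr_ge0.
apply: contra_neqN v0 => /eqP/esym.
move=> /psumr_eq0P h; apply/rowP => k; rewrite mxE.
by apply/eqP; rewrite -sqrf_eq0 h// => l _; exact: sqr_ge0.
Qed.

(** Farkas' lemma.  To add a generator [P k], a form [c0] separating [b] from
    the other generators is used.  If it is negative at [P k], everything is
    projected along [P k] onto the kernel of [c0] and the induction hypothesis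
    is applied once more: a form separating the projections becomes, composed
    with the projection, a separating form vanishing at [P k], and a
    combination of the projections lifts with a coefficient of [P k] that is
    nonnegative by the signs of [c0]. *)
Lemma farkas (I : finType) (A : {set I}) (P : I -> 'rV[F]_n) (b : 'rV[F]_n) :
  (exists2 a : I -> F, forall j, j \in A -> 0 <= a j &
     \sum_(j in A) a j *: P j = b)
  \/ (exists2 c, forall j, j \in A -> 0 <= pairing (P j) c & pairing b c < 0).
Proof.
have [m leAm] := ubnP #|A|; elim: m A leAm P b => // m IH A leAm P b.
have [-> | [k kA]] := set_0Vmem A.
  have [-> | b0] := eqVneq b 0.
    by left; exists (fun=> 0) => //; rewrite big_set0.
  right; exists (- b^T) => [j|]; first by rewrite inE.
  by rewrite -scaleN1r pairingZr mulN1r oppr_lt0 pairing_tr_gt0.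
have leA'm : (#|A :\ k| < m)%N by move: leAm; rewrite (cardsD1 k A) kA.
have [[a a0 ab]|[c0 c0P c0b]] := IH _ leA'm P b.
  left; exists (fun j => if j == k then 0 else a j) => [j jA|].
    by case: eqP => // /eqP jk; apply: a0; rewrite !inE jk.
  rewrite (big_setD1 k)//= eqxx scale0r add0r -ab.
  by apply: eq_bigr => j /setD1P[/negbTE -> _].
have [Pk0|Pk0] := leP 0 (pairing (P k) c0).
  right; exists c0 => // j jA; have [->//|jk] := eqVneq j k.
  by apply: c0P; rewrite !inE jk.
pose t v := pairing v c0 / pairing (P k) c0.
pose pr v := v - t v *: P k.
have [[a a0 ab]|[c cP cb]] := IH _ leA'm (fun j => pr (P j)) (pr b).
  left; pose r := t b - \sum_(j in A :\ k) a j * t (P j).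
  exists (fun j => if j == k then r else a j) => [j jA|].
    case: eqP => [_|/eqP jk]; last by apply: a0; rewrite !inE jk.
    rewrite /r subr_ge0; apply: (@le_trans _ _ 0).
      apply: sumr_le0 => l lA; apply: mulr_ge0_le0; first exact: a0.
      by apply: mulr_ge0_le0; [exact: c0P|rewrite invr_le0 ltW].
    by apply: mulr_le0; [exact: ltW|rewrite invr_le0 ltW].
  rewrite (big_setD1 k)//= eqxx.
  under eq_bigr => j /setD1P[/negbTE -> _] do over.
  have -> : \sum_(j in A :\ k) a j *: P j =
      pr b + (\sum_(j in A :\ k) a j * t (P j)) *: P k.
    rewrite -ab scaler_suml -big_split/=; apply: eq_bigr => j _.
    by rewrite scalerBr scalerA subrK.
  by rewrite /r /pr scalerBl addrCA !subrK.
right; pose c' := c - (pairing (P k) c / pairing (P k) c0) *: c0.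
have c'E v : pairing v c' = pairing (pr v) c.
  rewrite /c' /pr -scaleNr pairingDr pairingZr pairingDl pairingNl pairingZl.
  by rewrite /t mulNr mulrAC [in RHS]mulrAC [pairing v c0 * _]mulrC.
exists c'; last by rewrite c'E.
move=> j jA; rewrite c'E; have [->|jk] := eqVneq j k.
  by rewrite /pr /t divff ?lt_eqF// scale1r subrr /pairing mul0mx mxE.
by apply: cP; rewrite !inE jk.
Qed.

(** This is Farkas' lemma for the vector [- P k]. *)
Lemma tucker_alternative (I : finType) (A : {set I}) (P : I -> 'rV[F]_n) k :
  k \in A ->
  (exists a : I -> F, [/\ forall j, j \in A -> 0 <= a j, 0 < a k &
     \sum_(j in A) a j *: P j = 0])
  \/ (exists2 c, forall j, j \in A -> 0 <= pairing (P j) c &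
        0 < pairing (P k) c).
Proof.
move=> kA; have [[a a0 ab]|[c cP cb]] := farkas A P (- P k).
  left; exists (fun j => a j + (j == k)%:R); split=> [j jA||].
  - by rewrite addr_ge0 ?a0.
  - by rewrite eqxx ltr_wpDl ?a0.
  - under eq_bigr do rewrite scalerDl.
    rewrite big_split/= ab (big_setD1 k)//= eqxx scale1r big1 ?addr0 ?addNr//.
    by move=> j /setD1P[/negbTE -> _]; rewrite scale0r.
by right; exists c => //; rewrite -oppr_lt0 -pairingNl.
Qed.

Lemma normalized_weights (V : lmodType F) (I : finType) (A : {set I})
    (a : I -> F) (P : I -> V) :
  let s := \sum_(j in A) a j in
  0 < s -> \sum_(j in A) a j *: P j = 0 ->
  \sum_(j in A) s^-1 * a j = 1 /\ \sum_(j in A) (s^-1 * a j) *: P j = 0.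
Proof.
move=> s s0 aP; split; first by rewrite -mulr_sumr mulVf ?gt_eqF.
by under eq_bigr do rewrite -scalerA; rewrite -scaler_sumr aP scaler0.
Qed.

(** Gordan's theorem; the positive form is a sum of forms each of which is
    positive at one of the vectors. *)
Lemma gordan (I : finType) (A : {set I}) (P : I -> 'rV[F]_n) :
  (exists a : I -> F, [/\ forall j, j \in A -> 0 <= a j,
     \sum_(j in A) a j = 1 & \sum_(j in A) a j *: P j = 0])
  \/ (exists c, forall j, j \in A -> 0 < pairing (P j) c).
Proof.
have [[k [kA [a [a0 ak aP]]]]|noa] := pselect (exists k, k \in A /\
    exists a : I -> F, [/\ forall j, j \in A -> 0 <= a j, 0 < a k &
     \sum_(j in A) a j *: P j = 0]).
  left; have s0 : 0 < \sum_(j in A) a j.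
    by rewrite (big_setD1 k)//= ltr_wpDr// sumr_ge0// => j /setD1P[_ /a0].
  have [s1 sP] := normalized_weights s0 aP.
  exists (fun j => (\sum_(j in A) a j)^-1 * a j); split=> // j jA.
  by rewrite mulr_ge0 ?a0// invr_ge0 ltW.
right; have /choice[c cP] k : exists c, k \in A ->
    (forall j, j \in A -> 0 <= pairing (P j) c) /\ 0 < pairing (P k) c.
  have [kA|_] := boolP (k \in A); last by exists 0.
  have [[a ha]|[c cP ck]] := tucker_alternative P kA; last by exists c.
  by case: noa; exists k; split=> //; exists a.
exists (\sum_(k in A) c k) => j jA; rewrite pairing_sumr (big_setD1 j)//=.
rewrite ltr_wpDr ?(cP j jA).2// sumr_ge0// => k /setD1P[_ kA].
exact: (cP k kA).1.
Qed.

(** Stiemke's theorem; the positive combination is a sum of combinations each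
    of which is positive at one of the indices. *)
Lemma stiemke (I : finType) (A : {set I}) (P : I -> 'rV[F]_n) :
  (exists2 a : I -> F, forall j, j \in A -> 0 < a j &
     \sum_(j in A) a j *: P j = 0)
  \/ (exists c, (forall j, j \in A -> 0 <= pairing (P j) c) /\
        exists2 k, k \in A & 0 < pairing (P k) c).
Proof.
have [hc|noc] := pselect (exists c,
  (forall j, j \in A -> 0 <= pairing (P j) c) /\
  exists2 k, k \in A & 0 < pairing (P k) c); [by right|left].
have /choice[a aP] k : exists a : I -> F, k \in A ->
    [/\ forall j, j \in A -> 0 <= a j, 0 < a k &
     \sum_(j in A) a j *: P j = 0].
  have [kA|_] := boolP (k \in A); last by exists (fun=> 0).
  have [[a ha]|[c cP ck]] := tucker_alternative P kA; first by exists a.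
  by case: noc; exists c; split=> //; exists k.
exists (fun j => \sum_(k in A) a k j) => [j jA|].
  rewrite (big_setD1 j)//=; have [_ aj _] := aP j jA.
  rewrite ltr_wpDr// sumr_ge0// => k /setD1P[_ kA].
  by have [h _ _] := aP k kA; exact: h.
under eq_bigr do rewrite scaler_suml.
by rewrite exchange_big big1//= => k kA; have [] := aP k kA.
Qed.

End Alternative.

(** * Signs of a vanishing weighted sum *)

Section WeightedSum.
Variables (F : realFieldType) (I : finType) (A : {set I}) (a e : I -> F).
Hypothesis ae0 : \sum_(j in A) a j * e j = 0.

Lemma convex_sum0_has_le0 :
  (forall j, j \in A -> 0 <= a j) -> \sum_(j in A) a j = 1 ->
  ~ (forall j, j \in A -> 0 < e j).
Proof.
move=> a0 a1 e0.
have aej0 j : j \in A -> a j * e j = 0.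
  by move: j; apply: psumr_eq0P => // j jA; rewrite mulr_ge0 ?a0// ltW ?e0.
move/eqP: a1; rewrite big1 => [|j jA]; first by rewrite eq_sym oner_eq0.
by move/eqP: (aej0 j jA); rewrite mulf_eq0 (gt_eqF (e0 j jA)) orbF => /eqP.
Qed.

Lemma positive_sum0_eq0 :
  (forall j, j \in A -> 0 < a j) -> (forall j, j \in A -> 0 <= e j) ->
  forall j, j \in A -> e j = 0.
Proof.
move=> a0 e0 j jA.
have : a j * e j = 0.
  move: j jA; apply: psumr_eq0P => // j jA.
  by rewrite mulr_ge0 ?e0// ltW ?a0.
by move/eqP; rewrite mulf_eq0 (gt_eqF (a0 j jA))/= => /eqP.
Qed.

End WeightedSum.

(** * Bilinear functions on a patch as linear forms of the lift *)

Section PatchTheory.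
Variables (R : realType) (T : mesh R) (i : 'I_(nb_nodes T)).
Implicit Types (p : 'rV[R]_2 -> R) (z : 'rV[R]_2) (c : 'cV[R]_3).

Let S := surrounding i.

Lemma hull_vertex (V : lmodType R) (I : finType) (K : {set I}) (P : I -> V) j :
  j \in K -> hull K P (P j).
Proof.
move=> jK; exists (fun k => (k == j)%:R); split=> [k _||]; first by [].
  rewrite (big_setD1 j)//= eqxx big1 ?addr0// => k.
  by move=> /setD1P[/negbTE ->].
rewrite (big_setD1 j)//= eqxx scale1r big1 ?addr0// => k.
by move=> /setD1P[/negbTE ->]; rewrite scale0r.
Qed.

Lemma patch_center : patch i (node i).
Proof.
by have [K KT iK] := node_vertex i; exists K; [split|]; rewrite ?inE//;
  exact: hull_vertex.
Qed.

Lemma mem_surrounding_patch j : j \in S -> patch i (node j).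
Proof. by rewrite inE => /andP[_ /asboolP]. Qed.

(** An element with vertex [i] has other vertices.  Nonemptiness makes the sum
    of positive weights positive, so that they can be normalized. *)
Lemma surrounding_nonempty : exists j, j \in S.
Proof.
have [K KT iK] := node_vertex i.
have : (0 < #|K :\ i|)%N by have := elt_card KT; rewrite (cardsD1 i) iK; case: #|_|.
case/card_gt0P => j /setD1P[ji jK]; exists j; rewrite inE ji; apply/asboolP.
by exists K; [split=> //|]; exact: hull_vertex.
Qed.

Lemma patch_nodes_sub_patch : patch_nodes i `<=` patch i.
Proof.
move=> _ [j /setU1P[->|jS] ->]; first exact: patch_center.
exact: mem_surrounding_patch.
Qed.

(** The lift makes sense at every point of the plane, so that it also
    describes bilinear functions off the nodes. *)
Definition lift_point z : 'rV[R]_3 :=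
  let dx := xcoord z - xcoord (node i) in
  let dy := ycoord z - ycoord (node i) in
  \row_(k < 3) [:: dx; dy; dx * dy]`_k.

Lemma lift_pointE z c : pairing (lift_point z) c =
  (xcoord z - xcoord (node i)) * c 0 0 + (ycoord z - ycoord (node i)) * c 1 0 +
  (xcoord z - xcoord (node i)) * (ycoord z - ycoord (node i)) * c 2%:R 0.
Proof.
rewrite /pairing mxE !big_ord_recl big_ord0 !mxE /= addr0 addrA.
by congr (_ * c _ _ + _ * c _ _ + _ * c _ _); apply: val_inj.
Qed.

Lemma lift_point_center c : pairing (lift_point (node i)) c = 0.
Proof. by rewrite lift_pointE !subrr !mul0r !addr0. Qed.

Lemma bilinear_on_pairing D c :
  bilinear_on D (fun z => pairing (lift_point z) c).
Proof.
set x0 := xcoord (node i); set y0 := ycoord (node i).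
exists (x0 * y0 * c 2%:R 0 - x0 * c 0 0 - y0 * c 1 0), (c 0 0 - y0 * c 2%:R 0),
  (c 1 0 - x0 * c 2%:R 0), (c 2%:R 0) => z _.
rewrite lift_pointE -/x0 -/y0; lra.
Qed.

Lemma bilinear_on_patchP p : bilinear_on (patch i) p ->
  exists c, forall z, patch i z ->
    p z = p (node i) + pairing (lift_point z) c.
Proof.
move=> [a [b [b' [d pE]]]].
set x0 := xcoord (node i); set y0 := ycoord (node i).
(* the gradient and the mixed second derivative of p at the centre *)
exists (\col_(k < 3) [:: b + d * y0; b' + d * x0; d]`_k) => z zi.
rewrite lift_pointE !mxE/= (pE z zi) (pE _ patch_center) -/x0 -/y0; lra.
Qed.

Lemma sum_weighted_differences p (a : 'I_(nb_nodes T) -> R) :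
  bilinear_on (patch i) p -> \sum_(j in S) a j *: lifted i j = 0 ->
  \sum_(j in S) a j * (p (node j) - p (node i)) = 0.
Proof.
move=> /bilinear_on_patchP[c pE] aP.
transitivity (pairing (\sum_(j in S) a j *: lifted i j) c); last first.
  by rewrite aP /pairing mul0mx mxE.
rewrite pairing_suml; apply: eq_bigr => j /mem_surrounding_patch jS.
by rewrite pairingZl (pE _ jS) addrC addKr.
Qed.

Lemma pmin_le p j : j \in S -> (pmin i p <= (p (node j))%:E)%E.
Proof. by move=> jS; rewrite /pmin; exact: bigmin_le_cond. Qed.

Lemma le_pmin p x : (forall j, j \in S -> x <= p (node j)) ->
  (x%:E <= pmin i p)%E.
Proof. by move=> h; apply: le_bigmin => [|j jS]; rewrite ?leey// lee_fin h. Qed.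

Lemma lt_pmin p x : (forall j, j \in S -> x < p (node j)) ->
  (x%:E < pmin i p)%E.
Proof. by move=> h; apply: lt_bigmin => [|j jS]; rewrite ?ltry// lte_fin h. Qed.

Lemma le_pmax p j : j \in S -> ((p (node j))%:E <= pmax i p)%E.
Proof. by move=> jS; rewrite /pmax; exact: le_bigmax_cond. Qed.

(** * The two equivalences *)

Lemma convex_locally_bounded p : bilinearly_convex i ->
  bilinear_on (patch i) p -> locally_bounded_by_neighbours i p.
Proof.
move=> [a [a0 a1 aP]] pQ; have s0 := sum_weighted_differences pQ aP.
split; rewrite leNgt; apply/negP => lt_p.
  apply: (convex_sum0_has_le0 s0 a0 a1) => j jS.
  by rewrite subr_gt0 -lte_fin (lt_le_trans lt_p)// pmin_le.
apply: (@convex_sum0_has_le0 _ _ S a (fun j => p (node i) - p (node j))) => //.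
  by under eq_bigr do rewrite -opprB mulrN; rewrite sumrN s0 oppr0.
move=> j jS.
by rewrite subr_gt0 -lte_fin (le_lt_trans _ lt_p)// le_pmax.
Qed.

Lemma locally_bounded_convex :
  (forall p, bilinear_on (patch i) p -> locally_bounded_by_neighbours i p) ->
  bilinearly_convex i.
Proof.
move=> bnd; have [//|[c cP]] := gordan S (lifted i).
have [+ _] := bnd _ (bilinear_on_pairing _ c).
by rewrite leNgt lift_point_center lt_pmin.
Qed.

Lemma strictly_convexW :
  strictly_bilinearly_convex i -> bilinearly_convex i.
Proof. by move=> [a [a0 a1 aP]]; exists a; split=> // j /a0/ltW. Qed.

Lemma strictly_convex_extremum p : strictly_bilinearly_convex i ->
  bilinear_on (patch i) p ->
  pmin i p = (p (node i))%:E \/ (p (node i))%:E = pmax i p ->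
  forall j, j \in S -> p (node j) = p (node i).
Proof.
move=> [a [a0 a1 aP]] pQ; have s0 := sum_weighted_differences pQ aP.
move=> [pm|pM] j jS; apply/eqP.
  rewrite -subr_eq0; apply/eqP.
  apply: (positive_sum0_eq0 s0 a0 _ jS) => k kS.
  by rewrite subr_ge0 -lee_fin -pm pmin_le.
rewrite eq_sym -subr_eq0; apply/eqP.
apply: (@positive_sum0_eq0 _ _ S a (fun j => p (node i) - p (node j))) => //.
  by under eq_bigr do rewrite -opprB mulrN; rewrite sumrN s0 oppr0.
by move=> k kS; rewrite subr_ge0 -lee_fin pM le_pmax.
Qed.

(** Constancy is only tested at the nodes, so this covers both readings of the
    maximum principle. *)
Lemma max_principle_strictly_convex D : patch_nodes i `<=` D ->
  bilinear_max_principle_wrt i D -> strictly_bilinearly_convex i.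
Proof.
move=> nD mp; have [[a a0 aP]|[c [cP [k kS ck]]]] := stiemke S (lifted i).
  have [k kS] := surrounding_nonempty.
  have s0 : 0 < \sum_(j in S) a j.
    rewrite (big_setD1 k)//= ltr_pwDl ?a0// sumr_ge0// => j /setD1P[_ jS].
    exact/ltW/a0.
  have [s1 sP] := normalized_weights s0 aP.
  exists (fun j => (\sum_(j in S) a j)^-1 * a j); split=> // j jS.
  by rewrite mulr_gt0 ?a0// invr_gt0.
have [[lemin _] eqc] := mp _ (bilinear_on_pairing _ c).
have pm : pmin i (fun z => pairing (lift_point z) c) =
    (pairing (lift_point (node i)) c)%:E.
  by apply/eqP; rewrite eq_le lemin/= le_pmin// lift_point_center.
have /(_ (node k) (node i)) := eqc (or_introl pm).
rewrite lift_point_center => ck0; move: ck.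
have -> : pairing (lifted i k) c = 0; last by rewrite ltxx.
apply: ck0; apply: nD; [exists k|exists i] => //; rewrite in_setU1 ?eqxx//.
by apply/orP; right.
Qed.

Lemma strictly_convex_max_principle_nodes :
  strictly_bilinearly_convex i -> bilinear_max_principle_nodes i.
Proof.
move=> sc p pQ; split; first exact/convex_locally_bounded/pQ/strictly_convexW.
move=> pE; have pj := strictly_convex_extremum sc pQ pE.
have {}pj z : patch_nodes i z -> p z = p (node i).
  by move=> [j /setU1P[->|jS] ->]; last exact: pj.
by move=> z w /pj -> /pj ->.
Qed.

Lemma nondegenerate_pairing_eq0 c : nondegenerate_patch i ->
  (forall j, j \in S -> pairing (lifted i j) c = 0) ->
  forall v, pairing v c = 0.
Proof.
move=> nd c0 v.
pose f : 'Hom('rV[R]_3, 'rV[R]_1) := linfun (mulmxr c).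
suff ker_full : (fullv <= lker f)%VS.
  have : v \in lker f by apply: (subvP ker_full); exact: memvf.
  by rewrite memv_ker lfunE /= => /eqP vc; rewrite /pairing vc mxE.
rewrite -nd; apply/span_subvP => _ /mapP[j jS ->].
rewrite memv_ker lfunE /=; apply/eqP/matrixP => k l.
by rewrite !ord1 [RHS]mxE; apply: c0; rewrite -mem_enum.
Qed.

Lemma strictly_convex_max_principle : nondegenerate_patch i ->
  strictly_bilinearly_convex i -> bilinear_max_principle i.
Proof.
move=> nd sc p pQ; split; first exact/convex_locally_bounded/pQ/strictly_convexW.
move=> pE; have pj := strictly_convex_extremum sc pQ pE.
have [c cE] := bilinear_on_patchP pQ.
have c0 : forall v, pairing v c = 0.
  apply: nondegenerate_pairing_eq0 nd _ => j jS.
  move: (pj j jS); rewrite (cE _ (mem_surrounding_patch jS)).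
  by move=> /(canRL (addKr _)); rewrite addNr.
by move=> z w /cE -> /cE ->; rewrite !c0.
Qed.

End PatchTheory.

Theorem theorem14 (R : realType) (T : mesh R) (i : 'I_(nb_nodes T))
    (hi : (i < nb_interior T)%N) :
  ((forall p : 'rV[R]_2 -> R, bilinear_on (patch i) p ->
      locally_bounded_by_neighbours i p)
   <-> bilinearly_convex i)
  /\ ((bilinear_max_principle_nodes i <-> strictly_bilinearly_convex i)
      /\ (nondegenerate_patch i ->
            (bilinear_max_principle i <-> strictly_bilinearly_convex i))).
Proof.
split; first split.
- exact: locally_bounded_convex.
- by move=> cvx p; exact: convex_locally_bounded.
split=> [|nd]; split.
- exact: max_principle_strictly_convex.
- exact: strictly_convex_max_principle_nodes.
- exact/max_principle_strictly_convex/patch_nodes_sub_patch.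
- exact: strictly_convex_max_principle.
Qed.
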